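(* Let $n \geq 4$ and let $W$ be a graph on $n$ vertices consisting of a cycle on $n-1$ vertices together with a single edge from a vertex of the cycle to the remaining vertex. Then for any $t \geq 2$ and integers $1 \leq k_1 \leq \cdots \leq k_t < n-1$ with $k_1 + \cdots + k_t = n$, the graph $\mathsf{FS}(W, K_{k_1,\ldots,k_t})$ is connected if and only if $n$ is even or $t > 2$.
   Context: All graphs are simple. For graphs $X, Y$ on $n$ vertices, the friends-and-strangers graph $\mathsf{FS}(X,Y)$ has as vertices all bijections $\sigma: V(X) \to V(Y)$; two bijections $\sigma, \sigma'$ are adjacent iff there is an edge $\{a,b\} \in E(X)$ with $\{\sigma(a),\sigma(b)\} \in E(Y)$, $\sigma'(a) = \sigma(b)$, $\sigma'(b) = \sigma(a)$, and $\sigma'(c) = \sigma(c)$ for all other $c$. $K_{k_1,\ldots,k_t}$ denotes the complete $t$-partite graph with partition classes of sizes $k_1,\ldots,k_t$. *)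

(* Defs.v *)
From mathcomp Require Import all_boot.

Set Implicit Arguments.
Unset Strict Implicit.
Unset Printing Implicit Defensive.

Record sgraph := SGraph {
  vertex :> finType;
  adj : rel vertex;
  adj_sym : symmetric adj;
  adj_irr : irreflexive adj }.

Definition connected (G : sgraph) : Prop :=
  0 < #|G| /\ forall x y : G, connect (@adj G) x y.

Definition bijectiveb (A B : finType) (f : {ffun A -> B}) : bool :=
  injectiveb f && [forall y, exists x, f x == y].

Lemma bijectivebP (A B : finType) (f : {ffun A -> B}) :
  reflect (bijective f) (bijectiveb f).
Proof.
apply: (iffP andP) => [[/injectiveP f_inj /forallP f_surj] | [g fK gK]].
  have fP y : {x | f x == y} by apply: sigW; apply/existsP; exact: f_surj.
  have gK : cancel (fun y => sval (fP y)) f by move=> y; apply/eqP/(svalP (fP y)).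
  by exists (fun y => sval (fP y)) => // x; apply: f_inj; rewrite gK.
split; first by apply/injectiveP; apply: can_inj fK.
by apply/forallP => y; apply/existsP; exists (g y); rewrite gK.
Qed.

Section FriendsAndStrangers.
Variables X Y : sgraph.

Definition FS_vertex := {s : {ffun X -> Y} | bijectiveb s}.

Definition FS_adj : rel FS_vertex := fun s s' =>
  [exists a : X, exists b : X,
    [&& adj a b, adj (val s a) (val s b),
        val s' a == val s b, val s' b == val s a &
        [forall c : X, (c != a) && (c != b) ==> (val s' c == val s c)]]].

Lemma FS_adj_sym : symmetric FS_adj.
Proof.
suff H s s' : FS_adj s s' -> FS_adj s' s by move=> s s'; apply/idP/idP; apply: H.
case/existsP=> a /existsP[b] /and5P[ab sab /eqP Ea /eqP Eb /forallP Ec].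
apply/existsP; exists a; apply/existsP; exists b.
rewrite ab Ea Eb adj_sym sab !eqxx /=; apply/forallP => c.
by rewrite [val s c == _]eq_sym; apply: Ec.
Qed.

Lemma FS_adj_irr : irreflexive FS_adj.
Proof.
move=> s; apply/negbTE/negP => /existsP[a] /existsP[b] /and5P[_ sab /eqP Ea _ _].
by rewrite -Ea adj_irr in sab.
Qed.

Definition FS : sgraph := SGraph FS_adj_sym FS_adj_irr.

End FriendsAndStrangers.

Section CompleteMultipartite.
Variables (t : nat) (k : t.-tuple nat).

(* The i-th partition class is the set of pairs with first component i. *)
Definition multipartite_vertex := {i : 'I_t & 'I_(tnth k i)}.

Definition multipartite_adj : rel multipartite_vertex :=
  fun x y => tag x != tag y.

Lemma multipartite_adj_sym : symmetric multipartite_adj.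
Proof. by move=> x y; rewrite /multipartite_adj eq_sym. Qed.

Lemma multipartite_adj_irr : irreflexive multipartite_adj.
Proof. by move=> x; rewrite /multipartite_adj eqxx. Qed.

Definition complete_multipartite : sgraph :=
  SGraph multipartite_adj_sym multipartite_adj_irr.

End CompleteMultipartite.

(* The sequence c lists the vertices of the cycle in cyclic order, and uv is the
   extra edge. Membership in c is tested because next c x = x off c. *)
Definition cycle_with_pendant (n : nat) (W : sgraph) : Prop :=
  #|W| = n /\
  exists (c : seq W) (u v : W),
    [/\ uniq c, size c = n.-1, u \in c, v \notin c &
        forall x y : W, adj x y =
          [|| (x \in c) && (y == next c x), (y \in c) && (x == next c y),
              (x == u) && (y == v) | (x == v) && (y == u)]].

(* Main.v *)
Require Import Defs.
From mathcomp Require Import all_boot.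
From mathcomp Require Import fingroup perm zify.

Set Implicit Arguments.
Unset Strict Implicit.
Unset Printing Implicit Defensive.

(* A vertex of FS(W, K) seats the people of K on W, and the colour of a person is
   her partition class. The permutations g of the people preserving colours for
   which the seating s is connected to g s form a group depending only on the
   component of s; FS(W, K) is connected as soon as it contains every
   transposition of two people of the same colour.

   At the vertex of degree 3, a walk of six exchanges on its star, with two people
   a, b of one colour A and two people w, z not in A, realises (a b)(w z). By
   rotating the cycle, any two cyclically consecutive people of A can be brought to
   that star. If w and z have different colours they can be exchanged directly,
   which yields (a b) and settles t > 2.

   For two colours A, B with 2 <= |A| <= |B| and n even, letting A turn once around
   the cycle rotates the |B| - 1 people of B sitting there by |A|, which is not a
   multiple of |B| - 1 unless |B| = 2. Comparing the (a b)(w z) before and after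
   yields a 3-cycle of B, hence all of them by conjugation, and then all
   (x y)(w z). So up to a single tau = (w z) any two neighbours may be exchanged,
   at the price of one tau if they have the same colour. Rotating the cycle, of odd
   length, by one step by moving a person of A around, or one of B, costs numbers of
   tau of different parities, so that tau itself belongs to the group.

   For n odd and t = 2 both graphs are bipartite, and the sign of a bijection times
   the parity of the number of vertices on one side of W mapped to one side of K is
   invariant. *)

(** * Seatings as sequences *)

(* A seating of W is encoded as v :: c where v sits on the pendant vertex and c lists
   the people along the cycle, starting at the neighbour of the pendant vertex. *)

Lemma map_eq_cat_cons2 (T L : Type) (f : T -> L) t l1 x y l2 :
    map f t = l1 ++ x :: y :: l2 ->
  exists m1 x' y' m2, t = m1 ++ x' :: y' :: m2 /\
    [/\ map f m1 = l1, f x' = x, f y' = y & map f m2 = l2].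
Proof.
elim: l1 t => [|z l1 IH] [|z' t] //= [].
  by case: t => //= y' t ex [ey et]; exists [::], z', y', t.
move=> zz /IH[m1 [x' [y' [m2 [-> [e1 e2 e3 e4]]]]]].
by exists (z' :: m1), x', y', m2; rewrite /= zz e1.
Qed.

Lemma map_eq_cons2_rcons (T L : Type) (f : T -> L) t w x l y :
    map f t = w :: x :: rcons l y ->
  exists w' x' m y', t = w' :: x' :: rcons m y' /\
    [/\ f w' = w, f x' = x, map f m = l & f y' = y].
Proof.
case: t => [|w' [|x' t]] //= [ew ex].
case/lastP: t => [|m y']; first by case: l.
rewrite map_rcons => /rcons_inj[el ey].
by exists w', x', m, y'.
Qed.

Lemma map_tperm_notin (T : finType) (x y : T) l :
  x \notin l -> y \notin l -> map (tperm x y) l = l.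
Proof.
move=> xl yl; rewrite -[RHS]map_id; apply/eq_in_map => z zl.
by rewrite tpermD //; [apply: contraNneq xl => -> | apply: contraNneq yl => ->].
Qed.

Lemma map_tperm_adj (T : finType) l1 (x y : T) l2 : uniq (l1 ++ x :: y :: l2) ->
  map (tperm x y) (l1 ++ x :: y :: l2) = l1 ++ y :: x :: l2.
Proof.
rewrite cat_uniq /= inE !negb_or => /and3P[_ /and3P[xl1 yl1 _]].
case/and3P=> /andP[nxy xl2] yl2 _.
by rewrite map_cat /= tpermL tpermR !map_tperm_notin.
Qed.

Lemma map_tperm_wrap (T : finType) w (x : T) l y : uniq (w :: x :: rcons l y) ->
  map (tperm x y) (w :: x :: rcons l y) = w :: y :: rcons l x.
Proof.
rewrite /= rcons_uniq !inE !mem_rcons !inE !negb_or.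
case/and4P=> /and3P[wx wy wl] /andP[nxy xl] yl _.
by rewrite map_rcons tpermL tpermR map_tperm_notin // tpermD // eq_sym.
Qed.

Section Reach.
Variable P : finType.
Implicit Types (al : rel P) (s t l : seq P) (x y : P).

(** The first constructor covers the pendant edge ([l1] empty) and the cycle edges between
    consecutive positions; the second is the edge closing the cycle, between position 1 and the last
    one. *)
Inductive move al : seq P -> seq P -> Prop :=
| MoveAdj l1 x y l2 : al x y -> move al (l1 ++ x :: y :: l2) (l1 ++ y :: x :: l2)
| MoveWrap w x l y : al x y -> move al (w :: x :: rcons l y) (w :: y :: rcons l x).

Inductive reach al s : seq P -> Prop :=
| ReachRefl : reach al s s
| ReachStep t t' : reach al s t -> move al t t' -> reach al s t'.

Lemma reach_trans al s t t' : reach al s t -> reach al t t' -> reach al s t'.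
Proof. by move=> st; elim=> // t1 t2 _ st1 m; apply: ReachStep m. Qed.

Lemma move_reach al s t : move al s t -> reach al s t.
Proof. exact: ReachStep (ReachRefl _ _). Qed.

Lemma reach_adj al l1 x y l2 :
  al x y -> reach al (l1 ++ x :: y :: l2) (l1 ++ y :: x :: l2).
Proof. by move=> /(MoveAdj l1)-/(_ l2)/move_reach. Qed.

Lemma reach_wrap al w x l y :
  al x y -> reach al (w :: x :: rcons l y) (w :: y :: rcons l x).
Proof. by move=> xy; apply/move_reach/MoveWrap. Qed.

Lemma reach_sym al s t : symmetric al -> reach al s t -> reach al t s.
Proof.
move=> alC; elim=> [|t1 t2 _ t1s m]; first exact: ReachRefl.
apply: reach_trans t1s; apply: move_reach.
by case: m => *; constructor; rewrite alC.
Qed.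

Lemma move_perm al s t : move al s t -> perm_eq s t.
Proof.
by case=> *; apply/seq.permP=> p; rewrite ?count_cat /= -?cats1 ?count_cat /=; lia.
Qed.

Lemma reach_perm_eq al s t : reach al s t -> perm_eq s t.
Proof. by elim=> // t1 t2 _ st /move_perm; apply: perm_trans. Qed.

Lemma reach_movel al l1 l x l2 :
  all (al^~ x) l -> reach al (l1 ++ l ++ x :: l2) (l1 ++ x :: l ++ l2).
Proof.
elim: l l1 => [|y l IH] l1 /=; first by move=> _; apply: ReachRefl.
case/andP=> yx lx; apply: reach_trans (reach_adj _ _ yx).
by have := IH (rcons l1 y) lx; rewrite -!cats1 -!catA.
Qed.

Lemma reach_mover al l1 x l l2 :
  all (al x) l -> reach al (l1 ++ x :: l ++ l2) (l1 ++ l ++ x :: l2).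
Proof.
elim: l l1 => [|y l IH] l1 /=; first by move=> _; apply: ReachRefl.
case/andP=> yx lx; apply: reach_trans (reach_adj _ _ yx) _.
by have := IH (rcons l1 y) lx; rewrite -!cats1 -!catA.
Qed.

Lemma reach_swap_blocks al l1 l l' l2 :
    (forall x y, x \in l -> y \in l' -> al x y) ->
  reach al (l1 ++ l ++ l' ++ l2) (l1 ++ l' ++ l ++ l2).
Proof.
elim: l' l1 => [|y l' IH] l1 H; first exact: ReachRefl.
apply: (@reach_trans _ _ (l1 ++ y :: l ++ l' ++ l2)).
  by apply: reach_movel; apply/allP=> x xl; apply: H; rewrite ?mem_head.
have := IH (rcons l1 y) _; rewrite -!cats1 -!catA; apply.
by move=> x z xl zl; apply: H; rewrite // inE zl orbT.
Qed.

Lemma reach_perm al l1 s t l2 :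
    {in s &, forall x y, al x y} -> perm_eq s t ->
  reach al (l1 ++ s ++ l2) (l1 ++ t ++ l2).
Proof.
elim: t s l1 => [|y t IH] s l1 H st.
  by rewrite (perm_nilP st); apply: ReachRefl.
have ys: y \in s by rewrite (perm_mem st) mem_head.
case/splitPr: ys H st => s1 s2 H st.
apply: (@reach_trans _ _ (l1 ++ y :: (s1 ++ s2) ++ l2)).
  rewrite -!catA; apply: reach_movel; apply/allP=> x xs.
  by apply: H; rewrite mem_cat ?xs ?mem_head ?orbT.
have := IH (s1 ++ s2) (rcons l1 y); rewrite -!cats1 -!(catA l1); apply.
  by move=> x z xs zs; apply: H; rewrite mem_cat inE orbCA -mem_cat ?xs ?zs orbT.
by rewrite -(perm_cons y) -(permPr st) perm_sym -cat1s perm_catCA.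
Qed.

(* A path for a more permissive relation is followed by skipping the exchanges
   that are invisible on the labels. *)
Lemma reach_proj (L : eqType) (lab : P -> L) al al' s s' t :
    (forall x y x' y', lab x' = lab x -> lab y' = lab y ->
       al' x y -> lab x <> lab y -> al x' y') ->
    reach al' s s' -> map lab t = map lab s ->
  exists2 t', reach al t t' & map lab t' = map lab s'.
Proof.
move=> H; elim=> [|s1 s2 _ IH m] ts; first by exists t => //; apply: ReachRefl.
have{IH ts} [t1 tt1 e1] := IH ts.
suff [t2 t12 e2]: exists2 t2, reach al t1 t2 & map lab t2 = map lab s2.
  by exists t2 => //; apply: reach_trans t12.
case: m e1 => {s1 s2} [l1 x y l2|w x l y] xy.
  rewrite map_cat /= => E; have [m1 [x' [y' [m2 [-> [e1 e2 e3 e4]]]]]] := map_eq_cat_cons2 E.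
  case: (lab x =P lab y) => e.
    by exists (m1 ++ x' :: y' :: m2); rewrite ?map_cat /= ?e1 ?e2 ?e3 ?e4 ?e //;
       apply: ReachRefl.
  exists (m1 ++ y' :: x' :: m2); last by rewrite !map_cat /= e1 e2 e3 e4.
  exact/reach_adj/(H x y).
rewrite /= map_rcons => E; have [w' [x' [m [y' [-> [ew ex el ey]]]]]] := map_eq_cons2_rcons E.
case: (lab x =P lab y) => e.
  by exists [:: w', x' & rcons m y']; rewrite /= ?map_rcons ?ew ?ex ?el ?ey ?e //;
     apply: ReachRefl.
exists [:: w', y' & rcons m x']; last by rewrite /= !map_rcons ew ey el ex.
exact/reach_wrap/(H x y).
Qed.

(** The last clause lets an unrestricted exchange be replayed under any relation that allows this
    one pair. *)
Lemma move_tperm al s t : uniq s -> move al s t ->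
  exists x y, [/\ x \in s, y \in s, x != y & t = map (tperm x y) s]
    /\ (al x y /\ forall al', al' x y -> move al' s t).
Proof.
move=> + m; case: m => {s t} [l1 x y l2|w x l y] xy Us; exists x, y.
  split; last by split=> // al'; apply: MoveAdj.
  rewrite !mem_cat !inE !eqxx !orbT map_tperm_adj //; split=> //.
  by move: Us; rewrite cat_uniq /= inE => /and3P[_ _ /andP[/norP[]]].
split; last by split=> // al'; apply: MoveWrap.
rewrite !(inE, mem_rcons) !eqxx !orbT map_tperm_wrap //; split=> //.
by move: Us; rewrite /= rcons_uniq mem_rcons !inE => /and3P[_ /norP[]].
Qed.

End Reach.

(** * Colours and holonomy *)

(** Entries [i.+1] and [i] are the two ends of [rot i.+1 s], so the last hypothesis links cyclic
    neighbours, and a chain from entry 0 links all. *)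
Lemma rot_pairs_equiv (T : eqType) (E : T -> T -> Prop) (s : seq T) :
    (forall x, E x x) -> (forall x y, E x y -> E y x) ->
    {in s & &, forall x y z, E x y -> E y z -> E x z} ->
    (forall i x l y, i < size s -> rot i s = x :: rcons l y -> E x y) ->
  {in s &, forall x y, E x y}.
Proof.
move=> Er Es Et Erot x y xs ys.
have ms i : i < size s -> nth x s i \in s by move=> /(mem_nth x).
suff E0 i : i < size s -> E (nth x s 0) (nth x s i).
  have s0: 0 < size s by case: (s) xs.
  have := E0 _ (etrans (index_mem x s) xs); have := E0 _ (etrans (index_mem y s) ys).
  rewrite !nth_index // => Ey /Es Ex; apply: Et Ex Ey => //; exact: ms.
elim: i => [//|i IH] lt_i.
have lt_i' := ltnW lt_i.
apply: (Et _ (nth x s i)); rewrite ?ms //; first 1 [lia | exact: IH].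
apply/Es/(Erot i.+1 _ (drop i.+2 s ++ take i s)) => //.
by rewrite /rot (drop_nth x) // (take_nth x) 1?ltnW //= -rcons_cat.
Qed.

Section Colours.
Variables (P : finType) (C : eqType) (col : P -> C).
Implicit Types (s t l : seq P) (x y : P) (g h : {perm P}).

Definition colour_neq : rel P := fun x y => col x != col y.
Notation creach := (reach colour_neq).

Lemma creach_sym s t : creach s t -> creach t s.
Proof. by apply: reach_sym => x y; rewrite /colour_neq eq_sym. Qed.

Definition colour_perm g := forall x, col (g x) = col x.

Lemma creach_map g s t : colour_perm g -> creach s t -> creach (map g s) (map g t).
Proof.
move=> cg; elim=> [|t1 t2 _ st1 m]; first exact: ReachRefl.
apply: ReachStep st1 _; case: m => *.
  by rewrite !map_cat; constructor; rewrite /colour_neq !cg.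
by rewrite /= !map_rcons; constructor; rewrite /colour_neq !cg.
Qed.

Definition holonomy s g := colour_perm g /\ creach s (map g s).

Lemma holonomy1 s : holonomy s 1.
Proof.
split=> [x|]; first by rewrite perm1.
by rewrite (eq_map (@perm1 P)) map_id; apply: ReachRefl.
Qed.

Lemma holonomyM s g h : holonomy s g -> holonomy s h -> holonomy s (g * h).
Proof.
move=> [cg rg] [ch rh]; split=> [x|]; first by rewrite permM ch cg.
rewrite (eq_map (permM g h)) (map_comp h g).
exact: reach_trans rh (creach_map ch rg).
Qed.

Lemma colour_permV g : colour_perm g -> colour_perm g^-1.
Proof. by move=> cg x; rewrite -[in RHS](permKV g x) cg. Qed.

Lemma holonomyV s g : holonomy s g -> holonomy s g^-1.
Proof.
move=> [cg rg]; have cV := colour_permV cg; split=> //; apply: creach_sym.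
by have := creach_map cV rg; rewrite -map_comp (eq_map (permK g)) map_id.
Qed.

Lemma holonomy_reach s t g : creach s t -> holonomy s g -> holonomy t g.
Proof.
move=> st [cg rg]; split=> //; apply: reach_trans (creach_sym st) _.
exact: reach_trans rg (creach_map cg st).
Qed.

Lemma colour_tperm x y : col x = col y -> colour_perm (tperm x y).
Proof. by move=> xy z; case: tpermP => [->|->|]. Qed.

(** [w] is on the pendant vertex, [z] on the vertex of degree 3, [a] and [b] on its two cycle
    neighbours. Each of the six exchanges pairs one of [w], [z] with one of [a], [b], so [w] and [z]
    may share a colour. *)
Lemma star_reach w z a l b :
    col a = col b -> col w != col a -> col z != col a ->
  creach [:: w, z, a & rcons l b] [:: z, w, b & rcons l a].
Proof.
move=> ab wa za.
have [wb zb] : col w != col b /\ col z != col b by rewrite -ab.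
have S x y := eq_sym (col x) (col y).
apply: reach_trans (reach_wrap w (a :: l) zb) _ => /=.
apply: reach_trans (@reach_adj _ _ [::] w b (a :: rcons l z) wb) _ => /=.
apply: reach_trans (@reach_adj _ _ [:: b] w a (rcons l z) wa) _ => /=.
apply: reach_trans (@reach_wrap _ _ b a (w :: l) z _) _ => /=.
  by rewrite /colour_neq S.
apply: reach_trans (@reach_adj _ _ [::] b z (w :: rcons l a) _) _ => /=.
  by rewrite /colour_neq S.
by apply: (@reach_adj _ _ [:: z] b w (rcons l a)); rewrite /colour_neq S.
Qed.

(** If [w] and [z] differ in colour, one more exchange along the pendant edge puts them back and
    leaves [tperm a b] alone. *)
Lemma star_holonomy w z a l b :
    uniq [:: w, z, a & rcons l b] ->
    col a = col b -> col w != col a -> col z != col a ->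
  holonomy [:: w, z, a & rcons l b]
    ((if col w == col z then tperm w z else 1) * tperm a b)%g.
Proof.
move=> U ab wa za; have R := star_reach l ab wa za.
move: U; rewrite /= rcons_uniq !inE !mem_rcons !inE !negb_or.
case/and5P=> /and4P[nwz nwa nwb wl] /and3P[nza nzb zl] /andP[nab al] bl _.
have E : map (tperm a b) [:: w, z, a & rcons l b] = [:: w, z, b & rcons l a].
  by rewrite /= map_rcons tpermL tpermR map_tperm_notin // !tpermD // eq_sym.
case: eqP => wz; split.
- by move=> x; rewrite permM !colour_tperm.
- rewrite (eq_map (permM _ _)) map_comp.
  have -> : map (tperm w z) [:: w, z, a & rcons l b] = [:: z, w, a & rcons l b].
    by rewrite /= map_rcons tpermL tpermR map_tperm_notin // !tpermD.
  by rewrite /= map_rcons tpermL tpermR map_tperm_notin // !tpermD // eq_sym.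
- by rewrite mul1g; apply: colour_tperm.
rewrite mul1g E; apply: reach_trans R _.
by apply: (@reach_adj _ _ [::]); rewrite /colour_neq eq_sym; apply/eqP.
Qed.

(** * Bringing cyclic neighbours of one colour to the star *)

Section ColourClass.
Variable (alpha : C).

Let class s := [seq x <- s | col x == alpha].
Let rest s := [seq x <- s | col x != alpha].
(* Exchanges inside alpha are forbidden, so that the cyclic order of alpha is kept,
   and the other people are followed only up to colour. *)
Let loose : rel P := fun x y => (col x != alpha) || (col y != alpha).

(** People of [alpha] only pass people outside [alpha], so the final block keeps their order in
    [s]. *)
Lemma loose_sort l s : reach loose (l ++ s) (l ++ rest s ++ class s).
Proof.
elim: s l => [|x s IH] l /=; first exact: ReachRefl.
have {}IH := IH (rcons l x); rewrite -!cats1 -!catA /= in IH.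
apply: reach_trans IH _; rewrite /rest /class /=.
case: eqP => x_al /=; last exact: ReachRefl.
apply: reach_mover; apply/allP=> y; rewrite mem_filter /loose => /andP[-> _].
by rewrite orbT.
Qed.

(** For one step, the first [alpha] person goes left to the vertex of degree 3, [z] goes right to
    the end of the cycle, and the closing edge exchanges the two. *)
Lemma loose_rot w z o s i :
    col z != alpha -> all (fun x => col x != alpha) o -> i <= size s ->
  reach loose [:: w, z & o ++ s] [:: w, z & o ++ rot i s].
Proof.
move=> z_al /allP o_al; elim: i => [|i IH] lt_i.
  by rewrite rot0; apply: ReachRefl.
apply: reach_trans (IH (ltnW lt_i)) _; rewrite rotS //.
case: (rot i s) => [|a l]; rewrite ?rot1_cons; first exact: ReachRefl.
apply: (@reach_trans _ _ _ [:: w, a, z & o ++ l]).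
  apply: (@reach_movel _ _ [:: w] (z :: o)); apply/allP=> x.
  by rewrite inE /loose => /predU1P[->|/o_al->]; rewrite ?z_al.
apply: (@reach_trans _ _ _ [:: w, a & rcons (o ++ l) z]).
  have := @reach_mover _ loose [:: w; a] z (o ++ l) [::].
  rewrite cats0 cats1; apply; apply/allP=> x _; by rewrite /loose z_al.
rewrite -rcons_cat; apply: reach_wrap; by rewrite /loose z_al orbT.
Qed.

(** Sort, rotate [alpha] by [i] and move the rest behind [a]: then [a] and [b] flank [z]. The
    projected walk controls only colours outside [alpha], so the seats of [w] and [z] are taken by
    some [w'] and [z'] of the same colours. *)
Lemma class_star_holonomy s w z i a l b :
    uniq s -> w \in s -> z \in s -> w != z -> col w != alpha -> col z != alpha ->
    i < size (class s) -> rot i (class s) = a :: rcons l b ->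
  exists w' z', [/\ w' != z', col w' = col w, col z' = col z &
    holonomy s ((if col w == col z then tperm w' z' else 1) * tperm a b)%g].
Proof.
move=> Us ws zs wz w_al z_al lt_i def_i.
pose o := rem z (rem w (rest s)).
have Ur : uniq (rest s) by rewrite filter_uniq.
have rest_o : perm_eq (rest s) [:: w, z & o].
  rewrite (permPl (@perm_to_rem _ w _ _)) ?mem_filter ?w_al // perm_cons.
  by apply: perm_to_rem; rewrite mem_rem_uniq // !inE mem_filter z_al zs eq_sym wz.
have o_al : all (fun x => col x != alpha) o.
  by apply/allP=> x /mem_rem/mem_rem; rewrite mem_filter => /andP[].
have ab_al : (col a = alpha) * (col b = alpha).
  have in_al x : x \in rot i (class s) -> col x = alpha.
    by rewrite mem_rot mem_filter => /andP[/eqP].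
  by split; apply: in_al; rewrite def_i !inE ?mem_rcons ?inE eqxx ?orbT.
have R : reach loose s [:: w, z, a & rcons (o ++ l) b].
  apply: reach_trans (loose_sort [::] s) _ => /=.
  apply: reach_trans (@reach_perm _ loose [::] _ _ (class s) _ rest_o) _.
    by move=> x y; rewrite mem_filter /loose => /andP[->].
  apply: reach_trans (loose_rot w z_al o_al (ltnW lt_i)) _; rewrite def_i.
  have := @reach_swap_blocks _ loose [:: w; z] o [:: a] (rcons l b).
  rewrite /= -rcons_cat; apply=> x y xo _; by rewrite /loose (allP o_al).
(* People of [alpha] keep their identity, the others only their colour. Loosely exchanged people of
   equal colour are outside [alpha], so their exchange is invisible. *)
pose lab x : C + P := if col x == alpha then inr x else inl (col x).
have lab_col x y : lab x = lab y -> col x = col y.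
  by rewrite /lab; do 2!case: eqP => // ?; [case=> -> | case].
have [x y x' y'|t st] := reach_proj (lab := lab) (al := colour_neq) _ R erefl.
  move=> /lab_col ex /lab_col ey; rewrite /loose /colour_neq ex ey => xy nlab.
  apply: contra_not_neq nlab => exy; move: xy.
  by rewrite /lab exy orbb => /negPf->.
rewrite map_cons map_cons -rcons_cons map_rcons => et.
have [w' [z' [[|a' l'] [b' [tE [ew ez //]]]]]] := map_eq_cons2_rcons et.
case=> {et} ea _ eb.
have {}ea : a' = a.
  by move: ea (lab_col _ _ ea) => + E; rewrite /lab E ab_al eqxx => -[].
have {}eb : b' = b.
  by move: eb (lab_col _ _ eb) => + E; rewrite /lab E ab_al eqxx => -[].
subst a' b' t; have Ut := etrans (esym (perm_uniq (reach_perm_eq st))) Us.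
have {ew}ew := lab_col _ _ ew; have {ez}ez := lab_col _ _ ez.
exists w', z'; split=> //; first by move: Ut => /= /andP[]; rewrite inE => /norP[].
apply: holonomy_reach (creach_sym st) _; rewrite -ew -ez.
by apply: star_holonomy; rewrite ?Ut ?ew ?ez ?ab_al.
Qed.

(** [N] holds the side effects allowed outside the class: only 1 for three colours; any permutation
    fixing the class, or a single [tau], for two. The case [x = y] gives reflexivity even when 1 is
    not in [N]. *)
Definition exchangeable (N : {perm P} -> Prop) s x y :=
  x = y \/ exists2 g, N g & holonomy s (g * tperm x y).

(** Transitivity comes from [(x1 x2)(x2 x3)(x1 x2) = (x1 x3)]. The side effects combine to
    [g * h * g], which stays in [N = {tau}] although products do not. *)
Lemma class_exchangeable N s w z :
    uniq s -> w \in s -> z \in s -> w != z -> col w != alpha -> col z != alpha ->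
    (forall g x, N g -> col x = alpha -> g x = x) ->
    (forall g h, N g -> N h -> N (g * h * g)%g) ->
    (forall w' z' a b, w' != z' -> col w' = col w -> col z' = col z ->
       col a = alpha -> col b = alpha ->
       holonomy s ((if col w == col z then tperm w' z' else 1) * tperm a b)%g ->
       exchangeable N s a b) ->
  forall x y, x \in s -> y \in s -> col x = alpha -> col y = alpha ->
  exchangeable N s x y.
Proof.
move=> Us ws zs wz w_al z_al Nfix NM Nstar x y xs ys x_al y_al.
apply: (@rot_pairs_equiv _ (exchangeable N s) (class s));
  rewrite ?mem_filter ?x_al ?y_al ?eqxx ?xs ?ys //.
- by left.
- by move=> x1 y1 [->|[g Ng]]; [left | right; exists g; rewrite // tpermC].
- move=> x1 x2 x3; rewrite !mem_filter => /andP[/eqP a1 _] /andP[/eqP a2 _].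
  case/andP=> /eqP a3 _ [-> //|[g Ng Hg]] [<-|[h Nh Hh]]; first by right; exists g.
  have com g' u v : N g' -> col u = alpha -> col v = alpha -> commute g' (tperm u v).
    move=> Ng' ua va; have := tpermJ u v g'; rewrite !(Nfix g') // => E.
    by rewrite /commute [RHS]conjgC E.
  case: (x1 =P x3) => [|/eqP n13]; first by left.
  have [->|n12] := eqVneq x1 x2; first by right; exists h.
  have [<-|n23] := eqVneq x2 x3; first by right; exists g.
  right; exists (g * h * g)%g; first exact: NM.
  suff <- : (g * tperm x1 x2 * (h * tperm x2 x3) * (g * tperm x1 x2) =
             g * h * g * tperm x1 x3)%g.
    exact: holonomyM (holonomyM Hg Hh) Hg.
  have -> : tperm x1 x3 = (tperm x2 x3 ^ tperm x1 x2)%g.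
    by rewrite tpermJ tpermR tpermD // eq_sym.
  rewrite conjgE tpermV !mulgA -(mulgA g (tperm x1 x2) h) -(com h) // !mulgA.
  rewrite -(mulgA _ (tperm x2 x3) g) -(com g) // !mulgA.
  by rewrite -(mulgA _ (tperm x1 x2) g) -(com g) // !mulgA.
- move=> i a l b lt_i def_i.
  have [w' [z' [n' ew ez Hs]]] := class_star_holonomy Us ws zs wz w_al z_al lt_i def_i.
  have in_al u : u \in rot i (class s) -> col u = alpha.
    by rewrite mem_rot mem_filter => /andP[/eqP].
  by apply: Nstar Hs => //; apply: in_al; rewrite def_i !inE ?mem_rcons ?inE eqxx ?orbT.
Qed.

End ColourClass.

(** Follow a walk of unrestricted exchanges from [s] to [t]; an exchange of equal colours is
    replaced by a walk for the same transposition, transported to the current seating. *)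
Lemma creach_all s t : uniq s -> perm_eq s t ->
    (forall x y, x \in s -> y \in s -> x != y -> col x = col y ->
       holonomy s (tperm x y)) ->
  creach s t.
Proof.
move=> Us st Hs; have := @reach_perm _ (fun _ _ => true) [::] s t [::].
rewrite /= !cats0 => /(_ (fun _ _ _ _ => isT) st); elim=> [|t1 t2 _ st1 m].
  exact: ReachRefl.
have e1 := reach_perm_eq st1; have U1 := etrans (esym (perm_uniq e1)) Us.
case: (move_tperm U1 m) => x [y [[x1 y1 xy e] [_ Hm]]].
case: (col x =P col y) => [cxy|/eqP cxy]; last exact: ReachStep st1 (Hm _ cxy).
apply: (reach_trans st1); rewrite e.
rewrite -(perm_mem e1) in x1; rewrite -(perm_mem e1) in y1.
by case: (holonomy_reach st1 (Hs _ _ x1 y1 xy cxy)).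
Qed.

Lemma creach_pattern s t : perm_eq s t ->
  exists2 t', creach s t' & map col t' = map col t.
Proof.
move=> st; have := @reach_perm _ (fun _ _ => true) [::] s t [::].
rewrite /= !cats0 => /(_ (fun _ _ _ _ => isT) st) R.
apply: (reach_proj _ R) (erefl _) => x y x' y' ex ey _ /eqP.
by rewrite /colour_neq ex ey.
Qed.

Theorem creach_three_colours s t : uniq s -> perm_eq s t ->
    (forall x, x \in s -> exists w z, [/\ w \in s, z \in s, col w != col x,
       col z != col x & col w != col z]) ->
  creach s t.
Proof.
move=> Us st H3; apply: creach_all => // x y xs ys nxy cxy.
have [w [z [ws zs wx zx wz]]] := H3 x xs.
have nwz : w != z by apply: contraNneq wz => ->.
have [|||e|[g ->]] := @class_exchangeable (col x) (fun g => g = 1%g) s w z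
  Us ws zs nwz wx zx _ _ _ x y xs ys erefl (esym cxy).
- by move=> g u -> _; rewrite perm1.
- by move=> g h -> ->; rewrite !mul1g.
- by move=> w' z' a b _ _ _ _ _; rewrite (negPf wz); right; exists 1%g.
- by rewrite e eqxx in nxy.
by rewrite mul1g.
Qed.

End Colours.

(** * Two colours *)

Lemma iter_rot1 (T : Type) (s : seq T) i : i <= size s -> iter i (rot 1) s = rot i s.
Proof. by elim: i => [|i IH] lt_i; rewrite ?rot0 //= IH 1?ltnW // -rotS. Qed.

(** [rot i] is the identity once [i] reaches the size, whereas a block may have to turn further;
    hence the iterated [rot 1] and the index modulo the size. *)
Lemma head_iter_rot1 (T : Type) (x : T) s i :
  0 < size s -> head x (iter i (rot 1) s) = nth x s (i %% size s).
Proof.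
move=> s0; have E : iter (size s) (rot 1) s = s by rewrite iter_rot1 ?rot_size.
rewrite {1}(divn_eq i (size s)) addnC iterD iterM (iter_fix _ E) iter_rot1.
  2: by rewrite ltnW ?ltn_mod.
by rewrite -nth0 nth_cat size_drop nth_drop addn0 subn_gt0 ltn_mod s0.
Qed.

Section TwoColours.
Variables (P : finType) (C : eqType) (col : P -> C) (al be : C).
Hypothesis al_be : al != be.
Hypothesis cover : forall x, (col x == al) || (col x == be).
Implicit Types (s t l : seq P) (x y : P) (g h : {perm P}).

Let not_al x : (col x != al) = (col x == be).
Proof.
by have := cover x; case: eqP => //= ->; rewrite (negPf al_be).
Qed.

Lemma two_colour_commute g h :
    (forall x, col x = al -> h x = x) -> (forall x, col x = be -> g x = x) ->
  commute g h.
Proof.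
move=> hx gx.
apply: (@perm_onC _ [set x | col x == al] [set x | col x == be]).
- apply/subsetP=> x; rewrite !inE => /eqP gxx; apply: contraT.
  by rewrite not_al => /eqP/gx.
- apply/subsetP=> x; rewrite !inE => hxx; rewrite -not_al.
  by apply: contra_neqN hxx => /eqP/hx.
rewrite -setI_eq0; apply/eqP/setP=> x; rewrite !inE -not_al.
exact: andbN.
Qed.

Lemma other_class_holonomy s w z :
    uniq s -> (forall x, x \in s) -> w != z -> col w = al -> col z = al ->
  forall x y, col x = be -> col y = be ->
  exchangeable col (fun g => forall u, col u = be -> g u = u) s x y.
Proof.
move=> Us ins nwz cw cz x y xb yb.
apply: (@class_exchangeable _ _ _ be _ _ w z) => //; rewrite ?cw ?cz //.
- by move=> g u gu /gu.
- by move=> g h gx hx u ub; rewrite !permM gx // hx // gx.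
move=> w' z' a b nw'z'; rewrite eqxx => cw' cz' _ _ Hs; right.
exists (tperm w' z') => // u ub.
by rewrite tpermD //; apply: contraNneq al_be => e;
  [rewrite -cw' e ub | rewrite -cz' e ub].
Qed.

Let not_be x : (col x != be) = (col x == al).
Proof.
by have := cover x; rewrite orbC; case: eqP => //= ->; rewrite eq_sym (negPf al_be).
Qed.

Notation creach := (reach (colour_neq col)).
Notation hol := (holonomy col).

Variables a0 a1 : P.
Hypothesis (a01 : a0 != a1) (a0_al : col a0 = al) (a1_al : col a1 = al).

(** Some [g * tperm x y] with [g] supported on [al] is a holonomy, and [g] commutes with the
    3-cycle, so conjugating by it amounts to conjugating by [tperm x y]. *)
Lemma three_cycle_conj s p q r x y :
    uniq s -> (forall x, x \in s) ->
    col p = be -> col q = be -> col r = be -> col x = be -> col y = be ->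
    hol s (tperm p q * tperm q r) ->
  hol s (tperm (tperm x y p) (tperm x y q) * tperm (tperm x y q) (tperm x y r)).
Proof.
move=> Us ins pb qb rb xb yb H; rewrite -!tpermJ -conjMg.
have [->|[g gb Hg]] := other_class_holonomy Us ins a01 a0_al a1_al xb yb.
  by rewrite tperm1 conjg1.
have <- : ((tperm p q * tperm q r) ^ (g * tperm x y) =
           (tperm p q * tperm q r) ^ tperm x y)%g.
  rewrite conjgM; congr (_ ^ _)%g.
  apply/conjg_fixP/commgP/commute_sym.
  apply: two_colour_commute => // u ua.
  have be_u v : col v = be -> v != u by move=> vb; apply: contraNneq al_be => e; rewrite -ua -vb e.
  by rewrite permM !tpermD ?be_u.
exact: holonomyM (holonomyV Hg) (holonomyM H Hg).
Qed.

(** Three conjugations send [p0] to [p], then the second point to [q], then the third to [r], each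
    fixing the points already placed. *)
Lemma all_three_cycles s p0 q0 r0 :
    uniq s -> (forall x, x \in s) ->
    col p0 = be -> col q0 = be -> col r0 = be -> p0 != q0 -> q0 != r0 -> p0 != r0 ->
    hol s (tperm p0 q0 * tperm q0 r0) ->
  forall p q r, col p = be -> col q = be -> col r = be ->
    p != q -> q != r -> p != r -> hol s (tperm p q * tperm q r).
Proof.
move=> Us ins pb0 qb0 rb0 pq0 qr0 pr0 H0 p q r pb qb rb pq qr pr.
have cT x y z : col x = be -> col y = be -> col z = be -> col (tperm x y z) = be.
  by move=> xb yb zb; rewrite colour_tperm // xb yb.
have nT g x y : x != y -> g x != g y by move=> ?; rewrite (inj_eq perm_inj).
have := three_cycle_conj Us ins pb0 qb0 rb0 pb0 pb H0; rewrite tpermL.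
have := nT (tperm p0 p) _ _ pq0; have := nT (tperm p0 p) _ _ qr0.
have := nT (tperm p0 p) _ _ pr0; rewrite tpermL.
have := cT _ _ _ pb0 pb qb0; have := cT _ _ _ pb0 pb rb0.
move: (tperm p0 p q0) (tperm p0 p r0) => q1 r1 rb1 qb1 pr1 qr1 pq1 H1.
have := three_cycle_conj Us ins pb qb1 rb1 qb1 qb H1.
rewrite tpermL (@tpermD _ q1 q p) 1?eq_sym //.
have := nT (tperm q1 q) _ _ qr1; have := nT (tperm q1 q) _ _ pr1.
rewrite tpermL (@tpermD _ q1 q p) 1?eq_sym //.
have := cT _ _ _ qb1 qb rb1.
move: (tperm q1 q r1) => r2 rb2 pr2 qr2 H2.
have := three_cycle_conj Us ins pb qb rb2 rb2 rb H2.
by rewrite tpermL !(@tpermD _ r2 r) // eq_sym.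
Qed.

(** Exchange [z] and [a] across the closing edge, bring [z] left past [l], then [a] right past [bs]
    and [z]: both blocks turn by one, in opposite senses. *)
Lemma blocks_rot w z bs l a :
    col z != col a -> all (fun x => col x == col z) bs ->
    all (fun x => col x == col a) l ->
  creach (w :: (z :: bs) ++ rcons l a) (w :: rcons bs z ++ a :: l).
Proof.
move=> za /allP bs_z /allP l_a.
have := @reach_wrap _ (colour_neq col) w z (bs ++ l) a za.
rewrite /= -!rcons_cat => R; apply: reach_trans R _.
apply: (@reach_trans _ _ _ (w :: a :: bs ++ z :: l)).
  have := @reach_movel _ (colour_neq col) (w :: a :: bs) l z [::].
  rewrite /= cats0 cats1 -rcons_cat; apply; apply/allP=> x /l_a/eqP.
  by rewrite /colour_neq eq_sym => ->.
rewrite -cat_rcons.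
have := @reach_mover _ (colour_neq col) [:: w] a (rcons bs z) l; apply.
rewrite all_rcons /colour_neq eq_sym za; apply/allP=> x /bs_z/eqP ->.
by rewrite eq_sym.
Qed.

Lemma blocks_rot_iter w s t i :
    0 < size s -> all (fun x => col x == be) s -> all (fun x => col x == al) t ->
    i <= size t ->
  creach (w :: s ++ rot i t) (w :: iter i (rot 1) s ++ t).
Proof.
move=> + + t_al; elim: i s => [|i IH] s s0 s_be lt_i; first by rewrite rot0; apply: ReachRefl.
rewrite iterSr; have s1_be : all (fun x => col x == be) (rot 1 s).
  by apply/allP=> x; rewrite mem_rot => /(allP s_be).
apply: reach_trans (IH _ _ s1_be (ltnW lt_i)); rewrite ?size_rot // rotS //.
have : all (fun x => col x == al) (rot i t).
  by apply/allP=> x; rewrite mem_rot => /(allP t_al).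
have := size_rot i t; case: (rot i t) => [|a l _]; first by move: lt_i => + /= e; rewrite -e.
case: s s_be s0 {s1_be} => //= z bs /andP[/eqP z_be bs_be] _ /andP[/eqP a_al l_al].
by rewrite !rot1_cons; apply: blocks_rot; rewrite ?z_be ?a_al // eq_sym.
Qed.

Lemma two_blocks_holonomy w z bs a l b :
    uniq (w :: (z :: bs) ++ a :: rcons l b) ->
    col w = be -> all (fun x => col x == be) (z :: bs) ->
    all (fun x => col x == al) (a :: rcons l b) ->
  hol (w :: (z :: bs) ++ a :: rcons l b) (tperm w z * tperm a b).
Proof.
move=> U w_be /= /andP[/eqP z_be /allP bs_be] /andP[/eqP a_al].
rewrite all_rcons => /andP[/eqP b_al _].
have R : creach (w :: (z :: bs) ++ a :: rcons l b) [:: w, z, a & rcons (bs ++ l) b].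
  rewrite rcons_cat; apply: (@reach_movel _ _ [:: w; z]); apply/allP=> x /bs_be/eqP xb.
  by rewrite /colour_neq xb a_al eq_sym.
apply: holonomy_reach (creach_sym R) _.
rewrite (perm_uniq (reach_perm_eq R)) in U.
have := star_holonomy (col := col) U; rewrite w_be z_be a_al b_al eqxx eq_sym.
by apply.
Qed.

Lemma exists_three_cycle s :
    uniq s -> (forall x, x \in s) ->
    1 < count (fun x => col x == al) s -> 2 < count (fun x => col x == be) s ->
    ~~ ((count (fun x => col x == be) s).-1 %| count (fun x => col x == al) s) ->
  exists p q r, [/\ col p = be, col q = be & col r = be] /\
    [/\ p != q, q != r, p != r & hol s (tperm p q * tperm q r)].
Proof.
move=> Us ins k_gt1 l_gt2 ndvd.
pose sb := [seq x <- s | col x == be]; pose sa := [seq x <- s | col x == al].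
have sba : perm_eq s (sb ++ sa).
  have -> : sa = [seq x <- s | predC (fun x => col x == be) x].
    by apply: eq_filter => x /=; rewrite not_be.
  by rewrite perm_sym perm_filterC.
have [t st et] := creach_pattern col sba.
pose t1 := take (size sb) t; pose t2 := drop (size sb) t.
have tE : t = t1 ++ t2 by rewrite cat_take_drop.
have e1 : map col t1 = map col sb by rewrite map_take et map_cat take_size_cat ?size_map.
have e2 : map col t2 = map col sa by rewrite map_drop et map_cat drop_size_cat ?size_map.
have all_col c u v : all (fun x => col x == c) u -> map col v = map col u ->
    all (fun x => col x == c) v.
  by move=> uc e; rewrite -(all_map col (pred1 c)) e all_map.
have t1_be := all_col _ _ _ (filter_all _ _) e1.
have t2_al := all_col _ _ _ (filter_all _ _) e2.
have sz1 : size t1 = count (fun x => col x == be) s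
  by rewrite -(size_map col) e1 size_map size_filter.
have sz2 : size t2 = count (fun x => col x == al) s
  by rewrite -(size_map col) e2 size_map size_filter.
have Ut : uniq t by rewrite -(perm_uniq (reach_perm_eq st)).
rewrite -sz1 -sz2 in k_gt1 l_gt2 ndvd.
move: t1 t2 t1_be t2_al k_gt1 l_gt2 ndvd tE {e1 e2 sz1 sz2} => [|w t1] [|a t2] // t1_be t2_al.
case/lastP: t2 t2_al => [|l b] // t2_al _ l_gt2 ndvd tE; rewrite /= in l_gt2 ndvd.
have /andP[/eqP w_be t1_be'] := t1_be.
(* A full turn restores the [al] block, while the [be] block is rotated once per person of [al]. *)
have step : creach (w :: t1 ++ a :: rcons l b)
    (w :: iter (size (a :: rcons l b)) (rot 1) t1 ++ a :: rcons l b).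
  by rewrite -{1}(rot_size (a :: rcons l b)); apply: blocks_rot_iter => //; lia.
set u := iter _ _ _ in step.
have u_t1 : perm_eq u t1.
  rewrite /u; elim: (size _) => //= i; apply: perm_trans; by rewrite perm_rot.
case: t1 => [|z bs] // in tE t1_be t1_be' l_gt2 ndvd u step u_t1 *.
have u_head := @head_iter_rot1 _ z (z :: bs) (size (a :: rcons l b)) isT.
rewrite -/u in u_head.
case: u step u_t1 u_head => [|z' bs'] step u_t1 /= u_head; first by move: (perm_size u_t1).
have u_be : all (fun x => col x == be) (z' :: bs') by rewrite (perm_all _ u_t1).
have [wz Uz] : w \notin z :: bs /\ uniq (z :: bs).
  by move: Ut; rewrite tE cat_uniq => /and3P[/andP[]].
(* [z'] has index [|al|] modulo [|be| - 1] in [z :: bs], and [z] has index 0. *)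
have nzz' : z != z'.
  apply: contra ndvd; rewrite u_head /dvdn -[z in z == _]/(nth z (z :: bs) 0).
  by rewrite (nth_uniq z _ _ Uz) // 1?eq_sym ?ltn_mod.
have nw v : v \in z :: bs -> w != v by move=> vz; apply: contraNneq wz => ->.
have z'_in : z' \in z :: bs by rewrite -(perm_mem u_t1) mem_head.
rewrite tE in Ut st.
(* [(w z)(a b)] and [(w z')(a b)] are both holonomies, and [(a b)] cancels in their quotient. *)
exists z, w, z'.
have H1 := two_blocks_holonomy Ut w_be t1_be' t2_al.
rewrite (perm_uniq (reach_perm_eq step)) in Ut.
have H2 := two_blocks_holonomy Ut w_be u_be t2_al.
have {}H2 := holonomy_reach (creach_sym step) H2.
have := holonomyM H1 (holonomyV H2).
rewrite invMg !tpermV mulgA -(mulgA (tperm w z)) tperm2 mulg1 (tpermC w z).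
move/(holonomy_reach (creach_sym st)) => H3.
split; split=> //.
- by case/andP: t1_be' => /eqP.
- by case/andP: u_be => /eqP.
- by rewrite eq_sym nw ?mem_head.
- exact: nw.
Qed.

(** * Exchanges up to a fixed transposition [tau = (b0 b1)] *)

Variables b0 b1 : P.
Hypothesis (b01 : b0 != b1) (b0_be : col b0 = be) (b1_be : col b1 = be).

(** Non-divisibility makes a full turn of [al] displace the [be] people on the cycle. If [|be| = 2]
    divisibility is automatic, but [be] then has no 3-cycle to produce. *)
Definition good_counts s :=
  [/\ uniq s, forall x, x \in s, 1 < count (fun x => col x == al) s,
      1 < count (fun x => col x == be) s &
      ~~ ((count (fun x => col x == be) s).-1 %| count (fun x => col x == al) s) ||
      (count (fun x => col x == be) s == 2)].

Lemma be_three_cycles s p q r : good_counts s ->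
    col p = be -> col q = be -> col r = be -> p != q -> q != r -> p != r ->
  hol s (tperm p q * tperm q r).
Proof.
move=> [Us ins k_gt1 l_gt1 ndvd] pb qb rb pq qr pr.
have l_gt2 : 2 < count (fun x => col x == be) s.
  rewrite -size_filter; apply: (@uniq_leq_size _ [:: p; q; r]).
    by rewrite /= !inE (negPf pq) (negPf pr) (negPf qr).
  by move=> x; rewrite !inE mem_filter ins => /or3P[]/eqP->; rewrite ?pb ?qb ?rb eqxx.
rewrite (gtn_eqF l_gt2) orbF in ndvd.
have [p0 [q0 [r0 [[? ? ?] [? ? ? H]]]]] := exists_three_cycle Us ins k_gt1 l_gt2 ndvd.
exact: (all_three_cycles Us ins _ _ _ _ _ _ H).
Qed.

(** [(p q)(r v)] is [(p q)(q r)] times [(q r)(r v)]; each factor is a 3-cycle or, when its outer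
    points coincide, the identity. *)
Lemma be_pairs s p q r v : good_counts s ->
    col p = be -> col q = be -> col r = be -> col v = be -> p != q -> r != v ->
  hol s (tperm p q * tperm r v).
Proof.
move=> gs pb qb rb vb pq rv.
have H3 x y z : col x = be -> col y = be -> col z = be -> x != y -> y != z ->
    hol s (tperm x y * tperm y z).
  move=> xb yb zb xy yz; have [<-|xz] := eqVneq x z; last exact: be_three_cycles.
  by rewrite (tpermC y) tperm2; apply: holonomy1.
case: (eqVneq q r) rv => [<-|qr] rv; first exact: H3.
have <- : (tperm p q * tperm q r * (tperm q r * tperm r v) = tperm p q * tperm r v)%g.
  by rewrite mulgA -(mulgA (tperm p q)) tperm2 mulg1.
by apply: holonomyM; apply: H3.
Qed.

(** In [be] this is a product of two transpositions of [be]. In [al] the star gives [(w z)(a b)]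
    with [w], [z] in [be], and multiplying by [tau (w z)] turns [(w z)] into [tau]. *)
Lemma tau_pairs s x y : good_counts s -> x != y -> col x = col y ->
  hol s (tperm b0 b1 * tperm x y).
Proof.
move=> gs nxy cxy; have [Us ins _ _ _] := gs.
have [xb|] := eqVneq (col x) be; first by apply: be_pairs; rewrite -?cxy.
rewrite not_be => /eqP xa.
have w_al u : col u = be -> col u != al by move=> ->; rewrite eq_sym.
have [|||e|[g <-]] // := @class_exchangeable _ _ col al (eq (tperm b0 b1)) s b0 b1
  Us (ins _) (ins _) b01 (w_al _ b0_be) (w_al _ b1_be) _ _ _ x y (ins _) (ins _) xa
  (etrans (esym cxy) xa).
- move=> _ u <- ua; rewrite tpermD //.
    by apply: contraNneq al_be => e; rewrite -ua -e b0_be.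
  by apply: contraNneq al_be => e; rewrite -ua -e b1_be.
- by move=> _ _ <- <-; rewrite tperm2 mul1g.
- move=> w z a b wz; rewrite b0_be b1_be eqxx => wb zb _ _ H; right.
  exists (tperm b0 b1) => //.
  have := holonomyM (be_pairs gs b0_be b1_be wb zb b01 wz) H.
  by rewrite mulgA -(mulgA (tperm b0 b1)) tperm2 mulg1.
by rewrite e eqxx in nxy.
Qed.

Let tau_if (b : bool) t := if b then map (tperm b0 b1) t else t.

Let tau_ifK b b' t : tau_if b (tau_if b' t) = tau_if (b (+) b') t.
Proof.
case: b; case: b' => //=; rewrite -map_comp -[RHS]map_id.
by apply: eq_map => x /=; rewrite tpermK.
Qed.

(* Up to tau, exchanging two neighbours of the same colour is free as well. *)
Lemma creach_adj_tau l1 x y l2 : good_counts (l1 ++ x :: y :: l2) ->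
  creach (l1 ++ x :: y :: l2) (tau_if (col x == col y) (l1 ++ y :: x :: l2)).
Proof.
move=> gs; have [Us _ _ _ _] := gs.
have m := @MoveAdj _ (fun _ _ => true) l1 x y l2 isT.
case: eqP => [cxy|/eqP cxy]; last exact: reach_adj.
rewrite /= -(map_tperm_adj Us) -map_comp -(eq_map (permM (tperm x y) (tperm b0 b1))).
have nxy : x != y.
  by move: Us; rewrite cat_uniq /= inE !negb_or => /and3P[_ _ /and3P[/andP[]]].
by case: (holonomyV (tau_pairs gs nxy cxy)); rewrite invMg !tpermV.
Qed.

Lemma good_counts_perm s t : perm_eq s t -> good_counts s -> good_counts t.
Proof.
move=> st [Us ins k1 l1 d]; split; rewrite -?(perm_uniq st) -?(seq.permP st) //.
by move=> x; rewrite -(perm_mem st).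
Qed.

Lemma creach_tau_if b s t : creach s t -> creach (tau_if b s) (tau_if b t).
Proof. by case: b => //; apply: creach_map; apply: colour_tperm; rewrite b0_be. Qed.

Lemma creach_mover_tau l1 x l l2 : good_counts (l1 ++ x :: l ++ l2) ->
  creach (l1 ++ x :: l ++ l2)
    (tau_if (odd (count (fun y => col x == col y) l)) (l1 ++ l ++ x :: l2)).
Proof.
elim: l l1 => [|y l IH] l1 gs /=; first exact: ReachRefl.
apply: reach_trans (creach_adj_tau gs) _; rewrite oddD oddb -tau_ifK.
apply: creach_tau_if.
have := IH (rcons l1 y); rewrite -!cats1 -!catA; apply.
apply: good_counts_perm gs; apply/seq.permP=> p; rewrite !count_cat /= !count_cat; lia.
Qed.

(** Either [p] walks right to the end of the cycle, or [z] does and is then exchanged with [p] over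
    the closing edge: up to [tau] the result is the same. The costs, the numbers of people in [l]
    coloured like [p] and like [z], add up to the odd [size l], so exactly one is odd. *)
Lemma tau_holonomy w p z l : good_counts [:: w, p, z & l] -> odd (size l) ->
  col p != col z -> creach [:: w, p, z & l] (map (tperm b0 b1) [:: w, p, z & l]).
Proof.
move=> gs odd_l pz; set s := [:: w, p, z & l] in gs *.
pose t := [:: w, z & rcons l p].
have R1 : creach s (tau_if (odd (count (fun y => col p == col y) l)) t).
  have := @creach_mover_tau [:: w] p (z :: l) [::]; rewrite /= (negPf pz) add0n cats0 cats1.
  exact.
have R2 : creach s (tau_if (odd (count (fun y => col z == col y) l)) t).
  have := @creach_mover_tau [:: w; p] z l [::]; rewrite /= cats0 cats1 => /(_ gs) R.
  exact (reach_trans R (creach_tau_if _ (reach_wrap w l pz))).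
have : odd (count (fun y => col p == col y) l) (+) odd (count (fun y => col z == col y) l).
  have E : (fun y => col z == col y) =1 predC (fun y => col p == col y).
    move=> y /=; move: pz; have := cover p; have := cover z; have := cover y.
    by do 3!case/pred2P=> ->; rewrite ?eqxx // => _; rewrite ?(negPf al_be) // eq_sym (negPf al_be).
  by rewrite (eq_count E) -oddD count_predC.
move: (odd _) (odd _) R1 R2 => [] [] //= R1 R2 _.
- exact: reach_trans R2 (creach_tau_if true (creach_sym R1)).
- exact: reach_trans R1 (creach_tau_if true (creach_sym R2)).
Qed.

End TwoColours.

Lemma count_gt1P (T : eqType) (a : pred T) (s : seq T) : uniq s -> 1 < count a s ->
  exists x y, [/\ x \in s, y \in s, x != y, a x & a y].
Proof.
rewrite -size_filter => /(filter_uniq a).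
case E: (filter a s) => [|x [|y l]] //; rewrite /= inE => /andP[/norP[xy _] _] _.
have : x \in filter a s by rewrite E mem_head.
have : y \in filter a s by rewrite E !inE eqxx orbT.
by rewrite !mem_filter => /andP[ay ys] /andP[ax xs]; exists x, y.
Qed.

Theorem creach_two_colours (P : finType) (C : eqType) (col : P -> C) (al be : C) s t :
    al != be -> (forall x, (col x == al) || (col x == be)) ->
    uniq s -> (forall x, x \in s) -> ~~ odd (size s) ->
    1 < count (fun x => col x == al) s ->
    count (fun x => col x == al) s <= count (fun x => col x == be) s ->
  perm_eq s t -> reach (colour_neq col) s t.
Proof.
move=> al_be cover Us ins even_s k_gt1 k_le_l st.
have [a0 [a1 [a0s a1s a01 /eqP a0_al /eqP a1_al]]] := count_gt1P Us k_gt1.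
have [b0 [b1 [b0s b1s b01 /eqP b0_be /eqP b1_be]]] := count_gt1P Us (leq_trans k_gt1 k_le_l).
have ab a b : col a = al -> col b = be -> a != b.
  by move=> aa bb; apply: contraNneq al_be => e; rewrite -aa e bb.
have [l s_l] : exists l, perm_eq s [:: b0, a0, b1 & l].
  exists (rem b1 (rem a0 (rem b0 s))).
  rewrite (permPl (perm_to_rem b0s)) perm_cons.
  have a0s' : a0 \in rem b0 s by rewrite mem_rem_uniq // !inE ab.
  rewrite (permPl (perm_to_rem a0s')) perm_cons; apply: perm_to_rem.
  by rewrite mem_rem_uniq ?rem_uniq // !inE eq_sym ab // mem_rem_uniq // !inE eq_sym b01.
have gs : good_counts col al be s.
  split=> //; first exact: leq_trans k_le_l.
  have : size s = count (fun x => col x == al) s + count (fun x => col x == be) s.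
    rewrite -(count_predC (fun x => col x == al)); congr addn; apply: eq_count => x /=.
    by have := cover x; case: eqP => //= ->; rewrite (negPf al_be).
  move: even_s k_gt1 k_le_l.
  move: (count (fun x => col x == al) s) (count (fun x => col x == be) s) => k m.
  move=> even_s k_gt1 k_le_m sE; rewrite sE in even_s.
  have [->|m_neq2] := eqVneq m 2; first by rewrite orbT.
  rewrite orbF; apply/negP=> /dvdnP[q kE].
  (* [k = q * (m - 1) <= m] with [m > 2] and [k > 1] forces [q = 1], and then [k + m = 2 * m - 1] is
     odd. *)
  have q1 : q = 1 by nia.
  by move: even_s; rewrite kE q1; lia.
have gs0 := good_counts_perm s_l gs.
have ss0 : reach (colour_neq col) [:: b0, a0, b1 & l] (map (tperm b0 b1) [:: b0, a0, b1 & l]).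
  apply: (tau_holonomy al_be cover a01 a0_al a1_al b01 b0_be b1_be gs0).
    by move: even_s; rewrite (perm_size s_l) /= !negbK.
  by rewrite a0_al b1_be.
have hol0 : holonomy col [:: b0, a0, b1 & l] (tperm b0 b1).
  by split=> //; apply: colour_tperm; rewrite b0_be.
have all0 u : perm_eq [:: b0, a0, b1 & l] u -> reach (colour_neq col) [:: b0, a0, b1 & l] u.
  move=> s0u; apply: creach_all => // [|x y xs ys nxy cxy]; first by case: gs0.
  have := holonomyM hol0 (tau_pairs al_be cover a01 a0_al a1_al b01 b0_be b1_be gs0 nxy cxy).
  by rewrite mulgA tperm2 mul1g.
apply: reach_trans (creach_sym (all0 _ _)) (all0 _ _).
  by rewrite perm_sym.
by rewrite -(permPl s_l).
Qed.

(** * Back to graphs *)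

(** For the last entry the index runs past the end of [q], and the default value [u] closes the
    cycle. *)
Lemma nextE (T : eqType) (u : T) q x : x \in u :: q ->
  next (u :: q) x = nth u q (index x (u :: q)).
Proof. by move=> xq; rewrite next_nth xq. Qed.

(** [e] is the pendant vertex followed by the cycle, rotated to begin at the attachment vertex. For
    odd [n] the cycle is even and the parity of the position is a proper 2-colouring. *)
Lemma cycle_with_pendant_enum n (W : sgraph) : cycle_with_pendant n W ->
  exists e : seq W,
    [/\ uniq e, (forall a, a \in e) &
        [/\ forall l1 a b l2, e = l1 ++ a :: b :: l2 -> adj a b,
         forall w a l b, e = w :: a :: rcons l b -> adj a b &
        forall a b, 1 < n -> odd n -> adj a b -> odd (index a e) != odd (index b e)]].
Proof.
case=> cardW [c [u [v [Uc size_c uc vc adjE]]]].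
have [i q def_q] := rot_to uc.
have Uq : uniq (u :: q) by rewrite -def_q rot_uniq.
have cq : u :: q =i c by move=> x; rewrite -def_q mem_rot.
have nextq x : next c x = next (u :: q) x by rewrite -def_q next_rot.
have size_q : (size q).+1 = n.-1 by rewrite -size_c -(size_rot i c) def_q.
have {nextq} nextq x : x \in u :: q -> next c x = nth u q (index x (u :: q)).
  by rewrite nextq; apply: nextE.
have Ue : uniq (v :: u :: q) by rewrite cons_uniq cq vc.
have n_gt0 : 0 < n by rewrite -cardW; apply/card_gt0P; exists u.
exists (v :: u :: q); split=> //.
  move=> a; have /uniq_min_size : {subset v :: u :: q <= enum W} by move=> x; rewrite mem_enum.
  move=> /(_ Ue); rewrite -cardE cardW /= size_q prednK // leqnn => -[] // _ ->.
  by rewrite mem_enum.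
split.
- move=> [|w l] a b l2 []; first by move=> <- <- _; rewrite adjE !eqxx !orbT.
  move=> _ e.
  have al : a \notin l by move: Uq; rewrite e cat_uniq /= => /and3P[_ /norP[]].
  have aq : a \in u :: q by rewrite e mem_cat mem_head orbT.
  rewrite adjE -!cq aq nextq // e index_cat (negPf al) /= eqxx addn0.
  have -> : nth u q (size l) = nth u (u :: q) (size l).+1 by [].
  by rewrite e -cat_rcons nth_cat size_rcons ltnn subnn eqxx.
- move=> w a l b [_ ua e]; have bq : b \in u :: q by rewrite e inE mem_rcons mem_head orbT.
  rewrite adjE -!cq bq (nextq b) // nth_default ?ua ?eqxx ?orbT //.
  have bl : b \notin u :: l by move: Uq; rewrite e -rcons_cons rcons_uniq => /andP[].
  by rewrite e size_rcons -rcons_cons -cats1 index_cat -ua (negPf bl) /= eqxx addn0.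
move=> a b n_gt1 odd_n; rewrite adjE.
have step x y : (x \in c) && (y == next c x) ->
    odd (index x (v :: u :: q)) != odd (index y (v :: u :: q)).
  rewrite -cq => /andP[xq /eqP->]; rewrite nextq //.
  have idx z : z \in u :: q -> index z (v :: u :: q) = (index z (u :: q)).+1.
    by rewrite cq => zc; rewrite [LHS]/=; case: eqP vc => // ->; rewrite zc.
  have lt_x : index x (u :: q) < (size q).+1 by rewrite -[(size q).+1]/(size (u :: q)) index_mem.
  have [lt_i|ge_i] := ltnP (index x (u :: q)) (size q); last first.
    (* [x] is the last vertex, at index [n - 1] of the whole enumeration, even since [n] is odd; its
       successor [u] has index 1. *)
    have ix : index x (u :: q) = size q by lia.
    rewrite nth_default // !idx ?mem_head // ix [index u _]/= eqxx.
    by lia.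
  rewrite !idx //; last by rewrite inE mem_nth ?orbT.
  rewrite -[nth u q _]/(nth u (u :: q) (index x (u :: q)).+1) index_uniq //.
  by rewrite /=; case: (odd _).
have uv : u != v by move: Ue; rewrite /= inE eq_sym => /andP[/norP[]].
case/or4P=> [/step//|/step|/andP[/eqP-> /eqP->]|/andP[/eqP-> /eqP->]].
- by rewrite eq_sym.
- by rewrite /= !eqxx (eq_sym v) (negPf uv).
- by rewrite /= !eqxx (eq_sym v) (negPf uv).
Qed.

(** * From walks of seatings to paths in [FS] *)

Section Arrangements.
Variables (W Y : sgraph) (e : seq W).
Hypotheses (Ue : uniq e) (ine : forall a, a \in e).
Hypothesis adj_e : forall l1 a b l2, e = l1 ++ a :: b :: l2 -> adj a b.
Hypothesis adj_wrap_e : forall w a l b, e = w :: a :: rcons l b -> adj a b.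

Lemma FS_inj (s : FS W Y) : injective (val s).
Proof. by case: s => f /= /bijectivebP/bij_inj. Qed.

Lemma tperm_bijective (s : FS W Y) (a b : W) :
  bijectiveb [ffun c => val s (tperm a b c)].
Proof.
apply/bijectivebP; apply: (eq_bij (f := val s \o tperm a b)) => [|c]; last by rewrite ffunE.
by apply: bij_comp (injF_bij perm_inj); case: s => f /= /bijectivebP.
Qed.

Definition FS_tperm (s : FS W Y) (a b : W) : FS W Y :=
  exist (fun f => is_true (bijectiveb f)) _ (tperm_bijective s a b).

Lemma FS_tpermE (s : FS W Y) a b c : val (FS_tperm s a b) c = val s (tperm a b c).
Proof. by rewrite /= ffunE. Qed.

Lemma FS_adj_tperm (s : FS W Y) a b : adj a b -> adj (val s a) (val s b) ->
  adj s (FS_tperm s a b).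
Proof.
move=> ab sab; apply/existsP; exists a; apply/existsP; exists b.
rewrite ab sab !FS_tpermE tpermL tpermR !eqxx /=; apply/forallP=> c.
by apply/implyP=> /andP[ca cb]; rewrite ffunE tpermD // eq_sym.
Qed.

Definition seating (s : FS W Y) : seq Y := map (val s) e.

Lemma seating_inj : injective seating.
Proof.
move=> s t /eq_in_map E; apply/val_inj/ffunP=> a; exact: E.
Qed.

Lemma seating_uniq s : uniq (seating s).
Proof. by rewrite map_inj_uniq //; apply: FS_inj. Qed.

Lemma mem_seating s y : y \in seating s.
Proof.
case: s => f /= f_bij; have [g _ gK] := bijectivebP _ f_bij.
by rewrite -(gK y); apply: map_f.
Qed.

Lemma move_seating s l : move (@adj Y) (seating s) l ->
  exists2 s', adj s s' & seating s' = l.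
Proof.
move E: (seating s) => l0 m; case: m E => {l0 l} [l1 x y l2|w x l y] xy E.
  have [m1 [a [b [m2 [eE [<- ea eb <-]]]]]] := map_eq_cat_cons2 E.
  exists (FS_tperm s a b); first by apply: FS_adj_tperm; rewrite ?ea ?eb //; apply: adj_e eE.
  rewrite -ea -eb /seating (eq_map (FS_tpermE s a b)) map_comp eE map_tperm_adj -?eE //.
  by rewrite map_cat.
have [w' [a [m [b [eE [<- ea <- eb]]]]]] := map_eq_cons2_rcons E.
exists (FS_tperm s a b); first by apply: FS_adj_tperm; rewrite ?ea ?eb //; apply: adj_wrap_e eE.
rewrite -ea -eb /seating (eq_map (FS_tpermE s a b)) map_comp eE map_tperm_wrap -?eE //.
by rewrite !map_cons map_rcons.
Qed.

Lemma reach_seating s s' : reach (@adj Y) (seating s) (seating s') ->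
  connect (@adj (FS W Y)) s s'.
Proof.
move E: (seating s') => l R.
suff [t st tl] : exists2 t, connect (@adj (FS W Y)) s t & seating t = l.
  by rewrite (_ : s' = t) //; apply: seating_inj; rewrite E.
elim: R {E} => [|l1 l2 _ [t st <-] /move_seating[t' tt' <-]]; first by exists s.
by exists t' => //; apply: connect_trans st (connect1 tt').
Qed.

Lemma perm_seating s s' : perm_eq (seating s) (seating s').
Proof. by apply: uniq_perm; rewrite ?seating_uniq // => y; rewrite !mem_seating. Qed.

Lemma size_seating s : size (seating s) = #|W|.
Proof.
rewrite size_map cardE; apply/perm_size/uniq_perm; rewrite ?enum_uniq // => a.
by rewrite ine mem_enum.
Qed.

Lemma count_seating s (p : pred Y) : count p (seating s) = #|p|.
Proof.
rewrite cardE -size_filter; apply/perm_size/uniq_perm.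
- by rewrite filter_uniq ?seating_uniq.
- exact: enum_uniq.
by move=> y; rewrite mem_filter mem_seating mem_enum andbT.
Qed.

End Arrangements.

Lemma FS_inhabited (W Y : sgraph) : #|W| = #|Y| -> 0 < #|FS W Y|.
Proof.
move=> WY; pose f := [ffun a : W => enum_val (cast_ord WY (enum_rank a)) : Y].
have f_bij : bijectiveb f.
  apply/bijectivebP; exists (fun y => enum_val (cast_ord (esym WY) (enum_rank y))) => x.
    by rewrite ffunE enum_valK cast_ordK enum_rankK.
  by rewrite ffunE enum_valK cast_ordKV enum_rankK.
by apply/card_gt0P; exists (exist (fun f => is_true (bijectiveb f)) f f_bij).
Qed.

Section Multipartite.
Variables (t : nat) (k : t.-tuple nat).
Notation K := (complete_multipartite k).

Lemma card_class (i : 'I_t) : #|[pred y : K | tag y == i]| = tnth k i.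
Proof.
have inj : injective (fun j : 'I_(tnth k i) => (Tagged (fun i => 'I_(tnth k i)) j : K)).
  by move=> j j' /eqP; rewrite eq_Tagged => /eqP.
rewrite -[RHS]card_ord -(card_codom inj); apply: eq_card => -[i' j] /=.
rewrite inE /=; apply/eqP/codomP => [e|[j' []] //].
by subst i'; exists j.
Qed.

Lemma card_multipartite : #|K| = \sum_(i < t) tnth k i.
Proof.
rewrite -sum1_card (partition_big (fun y : K => tag y) xpredT) //=.
by apply: eq_bigr => i _; rewrite sum1_card card_class.
Qed.

End Multipartite.

(** * The parity obstruction for two bipartite graphs *)

Section Bipartite.
Variables (W Y : sgraph) (side : pred W) (cl : pred Y).
Hypothesis adj_side : forall a b : W, adj a b -> side a != side b.
Hypothesis adj_cl : forall x y : Y, adj x y -> cl x != cl y.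

Definition cross_parity (s : FS W Y) := \big[addb/false]_c (side c && cl (val s c)).

(** Exactly one end of the edge used is on [side], and its occupant changes class. *)
Lemma adj_cross_parity s s' : adj s s' ->
  exists a b, [/\ a != b, cross_parity s' = ~~ cross_parity s &
                 forall c, val s' c = val s (tperm a b c)].
Proof.
case/existsP=> a /existsP[b] /and5P[ab sab /eqP sa /eqP sb /forallP sc].
have nab : b != a by apply: contraTneq ab => ->; rewrite adj_irr.
have sc' c : c != a -> c != b -> val s' c = val s c.
  by move=> ca cb; have := sc c; rewrite ca cb => /eqP.
exists a, b; rewrite eq_sym; split=> // [|c]; last first.
  by case: tpermP => [->|->|/eqP ca /eqP cb]; rewrite ?sa ?sb ?sc'.
rewrite /cross_parity (bigD1 a) //= (bigD1 b) //=.
rewrite [in RHS](bigD1 a) //= [in RHS](bigD1 b) //=.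
rewrite (eq_bigr (fun c => side c && cl (val s c))) => [|c /andP[ca cb]]; last by rewrite sc'.
rewrite sa sb; have := adj_side ab; have := adj_cl sab.
by case: (side a) (side b) (cl _) (cl _) (\big[_/_]_(_ | _) _) => [] [] [] [] [].
Qed.

(** Each edge of the path contributes one transposition and flips the cross parity once. *)
Lemma connect_cross_parity (s s' : FS W Y) : connect (@adj (FS W Y)) s s' ->
  exists2 p : {perm W}, forall c, val s' c = val s (p c) &
    odd_perm p = cross_parity s (+) cross_parity s'.
Proof.
case/connectP=> l + ->; elim: l s => [|s1 l IH] s /=.
  by exists 1%g; [move=> c; rewrite perm1 | rewrite odd_perm1 addbb].
case/andP=> /adj_cross_parity[a [b [nab par_s1 s1E]]] /IH[p pE odd_p].
exists (p * tperm a b)%g; first by move=> c; rewrite permM -s1E.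
by rewrite odd_permM odd_tperm nab odd_p par_s1; case: cross_parity; case: cross_parity.
Qed.

(** Exchanging [y] and [y'] is an odd permutation that leaves the cross parity unchanged. *)
Lemma bipartite_FS_disconnected (y y' : Y) :
  y != y' -> cl y = cl y' -> ~ connected (FS W Y).
Proof.
move=> nyy' cyy' [/card_gt0P[s _] conn].
case: (bijectivebP _ (valP s)) => g sK gK.
have nab : g y != g y' by rewrite (can_eq gK).
have [p pE] := connect_cross_parity (conn s (FS_tperm s (g y) (g y'))).
have -> : p = tperm (g y) (g y').
  by apply/permP=> c; apply: (FS_inj (s := s)); rewrite -pE FS_tpermE.
rewrite odd_tperm nab; suff -> : cross_parity (FS_tperm s (g y) (g y')) = cross_parity s.
  by rewrite addbb.
apply: eq_bigr => c _; congr (_ && _); rewrite FS_tpermE.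
by case: tpermP => [->|->|//]; rewrite !gK.
Qed.

End Bipartite.

Lemma two_parts (k : 2.-tuple nat) : path leq 1 k ->
  [/\ 0 < tnth k ord0, tnth k ord0 <= tnth k ord_max & last 1 k = tnth k ord_max].
Proof.
by case: k => [[|k0 [|k1 []]] // sz] /=; rewrite !(tnth_nth 0) /= andbT => /andP[].
Qed.

Theorem theorem3p4 (n : nat) (n_ge4 : 4 <= n)
    (W : sgraph) (hW : cycle_with_pendant n W)
    (t : nat) (t_ge2 : 2 <= t) (k : t.-tuple nat)
    (k_chain : path leq 1 k) (k_last : last 1 k < n.-1)
    (k_sum : \sum_(i < t) tnth k i = n) :
  connected (FS W (complete_multipartite k)) <-> ~~ odd n \/ 2 < t.
Proof.
have cardW : #|W| = n by case: hW.
have [e [Ue ine [e_adj e_wrap e_odd]]] := cycle_with_pendant_enum hW.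
set K := complete_multipartite k.
have reach_connected : (forall s s' : FS W K,
    reach (colour_neq (fun y : K => tag y)) (seating e s) (seating e s')) ->
    connected (FS W K).
  move=> H; split; first by apply: FS_inhabited; rewrite cardW card_multipartite.
  by move=> s s'; apply: (reach_seating Ue ine e_adj e_wrap); apply: H.
have [t_gt2|t_le2] := ltnP 2 t.
  split; first by right.
  move=> _; apply: reach_connected => s s'.
  apply: creach_three_colours; [exact: seating_uniq | exact: perm_seating | move=> x _].
  have k_gt0 i : 0 < tnth k i.
    by have /allP := order_path_min leq_trans k_chain; apply; apply: mem_tnth.
  pose yi i : K := Tagged (fun i => 'I_(tnth k i)) (Ordinal (k_gt0 i)).
  have [i [j [ix jx ij]]] : exists i j : 'I_t, [/\ i != tag x, j != tag x & i != j].
    have /card_gt1P[i [j [ix jx ij]]] : 1 < #|predC1 (tag x)|.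
      by have := cardC1 (tag x); rewrite card_ord; lia.
    by exists i, j.
  by exists (yi i), (yi j); rewrite !mem_seating //; split.
have t2 : t = 2 by lia.
subst t; have [k0_gt0 k01 k1E] := two_parts k_chain.
have {}k_sum : tnth k ord0 + tnth k ord_max = n.
  rewrite -k_sum big_ord_recl big_ord1; congr (_ + tnth k _); exact: val_inj.
have [odd_n|even_n] := boolP (odd n); split=> //; [|by case | by left | move=> _].
  pose y (j : 'I_(tnth k ord_max)) : K := Tagged (fun i => 'I_(tnth k i)) j.
  have k1_gt1 : 1 < tnth k ord_max by lia.
  move=> conn; exfalso; move: conn.
  apply: (@bipartite_FS_disconnected _ _ (fun a => odd (index a e)) (fun y : K => tag y == ord0) _ _
    (y (Ordinal (ltnW k1_gt1))) (y (Ordinal k1_gt1))) => //.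
  - by move=> a b; apply: e_odd => //; lia.
  - move=> x z; rewrite [adj x z]/(tag x != tag z) -!val_eqE.
    by case: (tag x) (tag z) => [[|[|i]] //= ?] [[|[|j]] //= ?].
  by rewrite /y eq_Tagged.
apply: reach_connected => s s'.
apply: (@creach_two_colours _ _ _ ord0 ord_max) => //.
- by move=> x; rewrite -!val_eqE; case: (tag x) => [[|[|i]]].
- exact: seating_uniq.
- exact: mem_seating.
- by rewrite (size_seating Ue ine) cardW.
(* The bound [k_last] leaves at least two people for the smaller class. *)
- by rewrite (count_seating Ue ine) card_class; lia.
- by rewrite !(count_seating Ue ine) !card_class.
exact: perm_seating.
Qed.
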